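(* Let $\mu^-<\mu^+$, $\Lambda=(\mu^-,\mu^+)$, $P\in\mathcal P_\mu$. For every $k\in\mathbb Z$ for which the $k$-th eigenvalue $\lambda_k\in\Lambda$ of $A_0$ exists, with eigenfunction $z_k$, one has $$\mathrm{rot}(z_k)\in(k,k+1)\quad\text{if }\theta_*\in(0,\pi/2),\qquad \mathrm{rot}(z_k)\in\left(k-\tfrac12,k+\tfrac12\right)\quad\text{if }\theta_*\in(\pi/2,\pi).$$ Moreover, for all $k,l\in\mathbb Z$ with $k\ne l$ (for which $\lambda_k$ and $\lambda_l$ exist), $\mathrm{rot}(z_k)\ne\mathrm{rot}(z_l)$.
   Context: $M^2_S$ is the set of real symmetric $2\times2$ matrices and $J=\begin{pmatrix}0&1\\-1&0\end{pmatrix}$. Class $\mathcal P_\mu$: continuous maps $P:(0,+\infty)\to M^2_S$ such that (i) there is $q_\infty\ge1$ with $\lim_{x\to+\infty}P(x)=P_\infty:=\mathrm{diag}(\mu^-,\mu^+)$ and $\int_1^{+\infty}\|P(x)-P_\infty\|^{q_\infty}dx<+\infty$; (ii) there are $\beta\ge1$, $P^*\in M^2_S$, $q_0\ge1$ with $\lim_{x\to0^+}x^\beta P(x)=P^*$ and $\int_0^1x^{-\beta}\|x^\beta P(x)-P^*\|^{q_0}dx<+\infty$; (iii) $\det P^*<-1/4$ if $\beta=1$, and $\det P^*<0$ if $\beta>1$. $A_0z=\tau z:=Jz'+P(x)z$ with domain $D_0=\{z\in L^2(0,+\infty)$ ($\mathbb R^2$-valued): $z$ locally absolutely continuous, $\tau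 z\in L^2(0,+\infty)\}$ is self-adjoint, with simple eigenvalues in $\Lambda$. For a nontrivial solution $z=(u,v)$ of $Jz'+P(x)z=\lambda z$, $\lambda\in\Lambda$, an angular coordinate is a continuous $\theta$ with $u=\rho\cos\theta$, $v=\rho\sin\theta$; its limits $\theta(0)$ at $0^+$ and $\theta(+\infty)$ at $+\infty$ exist and are finite, and $\mathrm{rot}(z)=(\theta(+\infty)-\theta(0))/\pi$. Let $w_1^*=(w_{1,1}^*,w_{1,2}^* )$ be an eigenvector of $J^{-1}P^*$ for the eigenvalue $-\sqrt{-\det P^*}$ and $\theta_*\in[0,\pi)$ the angle with $w_1^*$ parallel to $(\cos\theta_*,\sin\theta_* )$ (i.e. $\theta_*=\arctan(w_{1,2}^*/w_{1,1}^* )$ mod $\pi$). For $\lambda\in\Lambda$ let $\zeta_{1,\lambda}$ be the nontrivial solution (unique up to a constant factor) with $\zeta_{1,\lambda}(x)\to0$ as $x\to0^+$, and $\vartheta(\cdot,\lambda)$ its angular coordinate normalized by $\vartheta(0,\lambda)=\theta_*$. Set $\nu(\lambda)=\lim_{x\to+\infty}\vartheta(x,\lambda)$ and $\nu^*(\lambda)=\nu(\lambda)+\arctan\sqrt{\frac{\lambda-\mu^-}{\mu^+-\lambda}}$, a strictly increasing function on $\Lambda$. For $k\in\mathbb Z$, $\lambda_k$ denotes the number in $\Lambda$ (if it exists) with $\nu^*(\lambda_k)=k\pi+\pi$, i.e. $\vartheta(+\infty,\lambda_k)=k\pi+\pi-\arctan\sqrt{\frac{\lambda_k-\mu^-}{\mu^+-\lambda_k}}$;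 it is an eigenvalue of $A_0$ and $z_k\in D_0$ is a corresponding eigenfunction. *)

(* Defs.v *)
From HB Require Import structures.
From mathcomp Require Export all_boot all_order all_algebra.
From mathcomp Require Export all_classical all_reals all_analysis.
Export Order.TTheory GRing.Theory Num.Theory.
Export numFieldNormedType.Exports.

Set Implicit Arguments.
Unset Strict Implicit.
Unset Printing Implicit Defensive.

Local Open Scope classical_set_scope.
Local Open Scope ring_scope.

(* Functions on (0, +oo) are represented by total functions on R; every
   definition below only looks at their values at positive arguments. *)

Definition mx2 (R : realType) (a b c d : R) : 'M[R]_2 :=
  \matrix_(i < 2, j < 2)
    if i == 0 then (if j == 0 then a else b) else (if j == 0 then c else d).

Definition vec2 (R : realType) (a b : R) : 'cV[R]_2 :=
  \col_(i < 2) if i == 0 then a else b.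

Definition Jmx (R : realType) : 'M[R]_2 := mx2 0 1 (-1) 0.

Definition Pinfty (R : realType) (mum mup : R) : 'M[R]_2 := mx2 mum 0 0 mup.

(* The matrix norm `|.| is the library's entrywise maximum norm; all the norms
   on 2 x 2 matrices give the same integrability conditions. *)
Definition cond_infty (R : realType) (P : R -> 'M[R]_2) (mum mup : R) : Prop :=
  exists qinf : R,
    [/\ 1 <= qinf,
        P x @[x --> +oo] --> Pinfty mum mup &
        (\int[@lebesgue_measure R]_(x in `[1%R, +oo[)
           (`|P x - Pinfty mum mup| `^ qinf)%:E < +oo)%E].

Definition cond_zero (R : realType) (P : R -> 'M[R]_2)
    (beta : R) (Pstar : 'M[R]_2) : Prop :=
  [/\ 1 <= beta,
      Pstar^T = Pstar,
      exists q0 : R,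
        [/\ 1 <= q0,
            x `^ beta *: P x @[x --> 0^'+] --> Pstar &
            (\int[@lebesgue_measure R]_(x in `]0%R, 1%R])
               (x `^ (- beta) * `|x `^ beta *: P x - Pstar| `^ q0)%:E
               < +oo)%E],
      beta = 1 -> \det Pstar < - (1 / 4) &
      1 < beta -> \det Pstar < 0].

Definition class_P (R : realType) (mum mup : R) (P : R -> 'M[R]_2) : Prop :=
  [/\ {within `]0, +oo[, continuous P},
      forall x, 0 < x -> (P x)^T = P x,
      cond_infty P mum mup &
      exists beta Pstar, cond_zero P beta Pstar].

Definition tau (R : realType) (P : R -> 'M[R]_2) (z : R -> 'cV[R]_2)
    (x : R) : 'cV[R]_2 :=
  Jmx R *m derive1 z x + P x *m z x.

Definition nontrivial (R : realType) (z : R -> 'cV[R]_2) : Prop :=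
  exists2 x, 0 < x & z x != 0.

Definition ode_solution (R : realType) (P : R -> 'M[R]_2) (lambda : R)
    (z : R -> 'cV[R]_2) : Prop :=
  forall x, 0 < x -> derivable z x 1 /\ tau P z x = lambda *: z x.

Definition L2 (R : realType) (z : R -> 'cV[R]_2) : Prop :=
  forall i : 'I_2,
    measurable_fun (`]0%R, +oo[%classic : set R) (fun x => z x i 0) /\
    (\int[@lebesgue_measure R]_(x in `]0%R, +oo[) (z x i 0 ^+ 2)%:E < +oo)%E.

Definition abs_continuous (R : realType) (a b : R) (z : R -> 'cV[R]_2) : Prop :=
  forall e, 0 < e -> exists2 d, 0 < d &
    forall (n : nat) (s t : 'I_n -> R),
      (forall i, [/\ a <= s i, s i <= t i & t i <= b]) ->
      trivIset setT (fun i => `]s i, t i[%classic) ->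
      \sum_(i < n) (t i - s i) < d ->
      \sum_(i < n) `|z (t i) - z (s i)| < e.

Definition loc_abs_continuous (R : realType) (z : R -> 'cV[R]_2) : Prop :=
  forall a b, 0 < a -> a <= b -> abs_continuous a b z.

(* tau z = g almost everywhere on (0, +oo).  Since derive1 z has an arbitrary value
   where z is not differentiable, differentiability has to be part of what
   holds almost everywhere (it does for every locally absolutely continuous
   z). *)
Definition tau_ae (R : realType) (P : R -> 'M[R]_2) (z g : R -> 'cV[R]_2) :
    Prop :=
  {ae @lebesgue_measure R, forall x,
    0 < x -> derivable z x 1 /\ tau P z x = g x}.

Definition D0 (R : realType) (P : R -> 'M[R]_2) (z : R -> 'cV[R]_2) : Prop :=
  [/\ L2 z, loc_abs_continuous z & exists2 g, L2 g & tau_ae P z g].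

Definition eigenfunction (R : realType) (P : R -> 'M[R]_2) (lambda : R)
    (z : R -> 'cV[R]_2) : Prop :=
  [/\ D0 P z, nontrivial z & tau_ae P z (fun x => lambda *: z x)].

Definition angular (R : realType) (z : R -> 'cV[R]_2) (theta : R -> R) : Prop :=
  {within `]0, +oo[, continuous theta} /\
  forall x, 0 < x -> exists2 rho : R, 0 < rho &
    z x = rho *: vec2 (cos (theta x)) (sin (theta x)).

Definition is_rot (R : realType) (z : R -> 'cV[R]_2) (r : R) : Prop :=
  exists theta theta0 thetainf,
    [/\ angular z theta,
        theta x @[x --> 0^'+] --> theta0,
        theta x @[x --> +oo] --> thetainf &
        r = (thetainf - theta0) / pi].

Definition is_theta_star (R : realType) (Pstar : 'M[R]_2) (theta : R) : Prop :=
  [/\ 0 <= theta, theta < pi &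
    exists w : 'cV[R]_2,
      [/\ w != 0,
          invmx (Jmx R) *m Pstar *m w = (- Num.sqrt (- \det Pstar)) *: w &
          exists c : R, w = c *: vec2 (cos theta) (sin theta)]].

Definition is_zeta1 (R : realType) (P : R -> 'M[R]_2) (lambda : R)
    (zeta : R -> 'cV[R]_2) : Prop :=
  [/\ ode_solution P lambda zeta, nontrivial zeta &
      zeta x @[x --> 0^'+] --> (0 : 'cV[R]_2)].

Definition is_vartheta (R : realType) (P : R -> 'M[R]_2) (thetastar lambda : R)
    (vartheta : R -> R) : Prop :=
  exists zeta,
    [/\ is_zeta1 P lambda zeta, angular zeta vartheta &
        vartheta x @[x --> 0^'+] --> thetastar].

Definition is_nu (R : realType) (P : R -> 'M[R]_2) (thetastar lambda nu : R) :
    Prop :=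
  exists2 vartheta, is_vartheta P thetastar lambda vartheta &
    vartheta x @[x --> +oo] --> nu.

Definition is_nustar (R : realType) (P : R -> 'M[R]_2)
    (mum mup thetastar lambda nustar : R) : Prop :=
  exists2 nu, is_nu P thetastar lambda nu &
    nustar = nu + atan (Num.sqrt ((lambda - mum) / (mup - lambda))).

(* lambda is the number lambda_k; that lambda_k exists means that such a lambda
   exists. *)
Definition is_lambda (R : realType) (P : R -> 'M[R]_2) (mum mup thetastar : R)
    (k : int) (lambda : R) : Prop :=
  [/\ mum < lambda, lambda < mup &
      is_nustar P mum mup thetastar lambda (k%:~R * pi + pi)].

(* Main.v *)
Require Import Defs.
From mathcomp Require Import measurable_realfun ring lra.
Local Open Scope classical_set_scope.
Local Open Scope ring_scope.

Set Implicit Arguments.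
Unset Strict Implicit.

(** Write [z' = J (P - lambda) z].  Along the solution [zeta] whose angle tends
    to [thetastar] at [0], the quantity [x |zeta|'/|zeta|] is eventually at least
    [1/2], since [x^beta P(x)] tends to [Pstar],
    [<J Pstar e, e> = sqrt (- det Pstar)] for the unit vector [e] of angle
    [thetastar], and this number exceeds [1/2]
    when [beta = 1].  Hence [|zeta|^2 <= C x] near [0].  The Wronskian [W] of an
    eigenfunction [z] and [zeta] is constant; were it nonzero,
    [W^2 <= |z|^2 |zeta|^2] would give [|z|^2 >= K / x], which is not
    integrable.  So [z] is a constant multiple of [zeta], their angles differ by
    a constant, and [rot z = k + 1 - (alpha + thetastar) / pi] with
    [alpha = atan (sqrt ...)] in [(0, pi/2)]; everything follows from this. *)

(** * Absolutely continuous functions with almost everywhere zero derivative *)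

Section absolute_continuity.
Context {R : realType}.
Implicit Types (a b : R) (f g : R -> R).

Definition abs_cont a b f := forall e, 0 < e -> exists2 d, 0 < d &
  forall (n : nat) (s t : 'I_n -> R),
    (forall i, [/\ a <= s i, s i <= t i & t i <= b]) ->
    trivIset setT (fun i => `]s i, t i[%classic) ->
    \sum_(i < n) (t i - s i) < d ->
    \sum_(i < n) `|f (t i) - f (s i)| < e.

(** List form of absolute continuity, suited to adding intervals one at a time. The list runs from
    right to left: a new rightmost interval is consed at the head. *)
Lemma ac_seq a b f e : abs_cont a b f -> 0 < e -> exists2 d, 0 < d &
  forall l : seq (R * R),
    all (fun p => [&& a <= p.1, p.1 <= p.2 & p.2 <= b]) l ->
    pairwise (fun p q => q.2 <= p.1) l ->
    \sum_(p <- l) (p.2 - p.1) < d ->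
    \sum_(p <- l) `|f p.2 - f p.1| < e.
Proof.
move=> acf e0; have [d d0 H] := acf _ e0; exists d => //
  l /allP lab /(pairwiseP (0, 0)) pl.
rewrite !(big_nth (0, 0)) !big_mkord => ld.
apply: (H _ (fun i => (nth (0, 0) l i).1) (fun i => (nth (0, 0) l i).2)) => //.
  by move=> i; have /lab /and3P[] := mem_nth (0, 0) (ltn_ord i).
move=> i j _ _ [x /= []]; rewrite !in_itv /= => /andP[x1 x2] /andP[x3 x4].
apply/val_inj => /=; case: (ltngtP i j) => // ij.
- have := pl _ _ (ltn_ord i) (ltn_ord j) ij.
  by move=> /(lt_le_trans x4) /lt_trans /(_ x1); rewrite ltxx.
- have := pl _ _ (ltn_ord j) (ltn_ord i) ij.
  by move=> /(lt_le_trans x2) /lt_trans /(_ x3); rewrite ltxx.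
Qed.

Lemma is_derive0_near f (x e : R) : is_derive x 1 f 0 -> 0 < e ->
  exists2 d, 0 < d & forall y, `|y - x| < d -> `|f y - f x| <= e * `|y - x|.
Proof.
move=> [+ +] e0; rewrite /derivable => df; rewrite /derive => df0.
have := df; rewrite -/(cvg _) => /cvgrPdist_le /(_ _ e0); rewrite df0 => -[/= d d0 H].
exists d => // y yd; have [->|yx] := eqVneq y x; first by rewrite !subrr normr0 mulr0.
have yx0 : y - x != 0 by rewrite subr_eq0.
have := H (y - x); rewrite /= sub0r normrN => /(_ yd yx0).
rewrite sub0r normrN normrZ normfV scaler1 subrK mulrC.
by rewrite ler_pdivrMr // normr_gt0.
Qed.

(* Cousin-type argument: the points [x] for which [f x - f a] is controlled by
   [e * (x - a)] plus the variation of [f] along disjoint intervals inside a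
   small neighbourhood [U] of the exceptional null set fill up [a, b]. *)
Lemma ac_derive0_cst a b f (N : set R) : a <= b -> abs_cont a b f ->
  (@lebesgue_measure R).-negligible N ->
  (forall x, a <= x <= b -> ~ N x -> is_derive x 1 f 0) -> f b = f a.
Proof.
move=> ab acf [B [mB B0 NB]] df.
suff H e : 0 < e -> `|f b - f a| <= e * (b - a) + e.
  apply/eqP; rewrite -subr_eq0 -normr_eq0 eq_le normr_ge0 andbT.
  apply/ler_addgt0Pl => e e0; rewrite addr0.
  (* With [e / (b - a + 1)] in place of [e] the bound becomes exactly [e]; the added 1 covers
     [a = b]. *)
  have ba : 0 < b - a + 1 by lra.
  have /le_trans := H (e / (b - a + 1)) (divr_gt0 e0 ba); apply.
  by rewrite -{2}[_ / _]mulr1 -mulrDr mulfVK // gt_eqF.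
move=> e0; have [d d0 acd] := ac_seq acf e0.
pose mu := @lebesgue_measure R; have {}B0 : mu B = 0%E by exact: B0.
(* Outer regularity: the null set [B] has an open neighbourhood of measure below the threshold [d]
   of absolute continuity. *)
have [U [oU BU mUB]] : exists U : set R, [/\ open U, B `<=` U &
    (mu (U `\` B) < d%:E)%E].
  apply: lebesgue_regularity_outer => //.
  apply: (@le_lt_trans _ _ 0%E) => //; rewrite le_eqVlt.
  by apply/orP; left; apply/eqP; exact: B0.
have mU : measurable U by exact: open_measurable.
have mUd : (mu U < d%:E)%E.
  apply: le_lt_trans mUB; rewrite -[X in (mu X <= _)%E](setDUK BU).
  apply: (le_trans (measureU2 _ _ _)) => //; first exact: measurableD.
  by rewrite [X in (X + _)%E]B0 add0e.
(* Bounding the total length by the measure of [U] up to [x] lets it be updated by additivity, and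
   finally keeps it below [d]. There are two ways to advance: [Q1] pays [e] times the length and
   keeps the list, [Q2] crosses a piece of [U] and records it in the list. *)
pose Q x := exists l : seq (R * R),
  [/\ all (fun p => [&& a <= p.1, p.1 <= p.2 & p.2 <= x]) l,
      pairwise (fun p q => q.2 <= p.1) l,
      ((\sum_(p <- l) (p.2 - p.1))%:E <= mu (U `&` `]a, x]))%E &
      `|f x - f a| <= e * (x - a) + \sum_(p <- l) `|f p.2 - f p.1| ].
have Qa : Q a by exists [::]; split; rewrite ?big_nil ?subrr ?normr0 ?mulr0 ?addr0 //.
have Q1 x y : a <= x -> x <= y -> `|f y - f x| <= e * (y - x) -> Q x -> Q y.
  move=> ax xy fxy [l [l1 l2 l3 l4]]; exists l; split=> //.
  - by apply: sub_all l1 => p /and3P[-> -> /= px]; exact: le_trans px xy.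
  - apply: (le_trans l3); apply: le_measure; rewrite ?inE.
    + exact: measurableI.
    + exact: measurableI.
    + apply: setIS => z /=; rewrite !in_itv /= => /andP[-> /= zx]; exact: le_trans zx xy.
  - have := ler_normD (f y - f x) (f x - f a); rewrite subrKA => h.
    apply: (le_trans h); lra.
have Q2 x y : a <= x -> x <= y -> `]x, y] `<=` U -> Q x -> Q y.
  move=> ax xy xyU [l [l1 l2 l3 l4]]; exists ((x, y) :: l); split.
  - rewrite /= ax xy lexx /=.
    by apply: sub_all l1 => p /and3P[-> -> /= px]; exact: le_trans px xy.
  - rewrite /= l2 andbT; by apply: sub_all l1 => p /and3P[].
  - rewrite big_cons /=.
    have -> : U `&` `]a, y] = `]x, y] `|` (U `&` `]a, x]).
      apply/seteqP; split => z /=; rewrite !in_itv /=.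
        move=> [Uz /andP[az zy]]; have [xz|zx] := ltP x z; [left|right].
          by rewrite zy.
        by rewrite az.
      move=> [/andP[xz zy]|[Uz /andP[az zx]]].
        split; last by rewrite (le_lt_trans ax xz).
        by apply: xyU; rewrite /= in_itv /= xz.
      by split => //; rewrite az (le_trans zx xy).
    rewrite /mu measureU //; last 2 first.
    + exact: measurableI.
    + rewrite -subset0 => z /= []; rewrite !in_itv /= => /andP[xz _] [_ /andP[_ zx]]; lra.
    rewrite EFinD; apply: leeD => //.
    rewrite -[leRHS]/(lebesgue_measure `]x, y]%classic) lebesgue_measure_itv /=.
    rewrite lte_fin; case: ltP => // yx.
    by rewrite lee_fin; lra.
  - rewrite big_cons /=.
    have := ler_normD (f y - f x) (f x - f a); rewrite subrKA => h.
    apply: (le_trans h).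
    have : e * (x - a) <= e * (y - a) by rewrite ler_pM2l // lerD2r.
    lra.
(* Each [c] has a radius within which [Q] passes from the left of [c] to its right. If [N c], the
   whole piece lies in [U]; otherwise the derivative estimate compares only with [f c], so the
   passage stops at [c]. *)
have key c : a <= c <= b -> exists2 r, 0 < r & forall x y, a <= x ->
   c - r < x -> x <= c -> c <= y -> y < c + r -> Q x -> Q y.
  move=> cab; have [Nc|Nc] := pselect (N c).
  - have Uc : U c by apply: BU; apply: NB.
    have /nbhs_ballP[r /= r0 rU] := open_nbhs_nbhs (conj oU Uc).
    exists r => // x y ax cx xc cy yc; apply: Q2; [lra|lra|].
    move=> z /=; rewrite in_itv /= => /andP[xz zy]; apply: rU.
    rewrite /ball /= ltr_norml; lra.
  - have [r r0 H] := is_derive0_near (df _ cab Nc) e0.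
    exists r => // x y ax cx xc cy yc Qx.
    apply: (Q1 c) => //; [lra| |].
      rewrite -(ger0_norm (_ : 0 <= y - c)); last lra.
      by apply: H; rewrite ger0_norm; lra.
    apply: (Q1 x) => //; rewrite distrC -(ger0_norm (_ : 0 <= c - x)); last lra.
    by rewrite (distrC c x); apply: H; rewrite ler0_norm; lra.
pose S := [set x | a <= x <= b /\ Q x].
have Sa : S a by split => //; rewrite lexx.
have hS : has_sup S.
  by split; [exists a | exists b => x [/andP[]]].
have c1 : a <= sup S by apply: sup_upper_bound.
have c2 : sup S <= b by apply: ge_sup => [|x [/andP[]] //]; exists a.
have [r r0 H] := key (sup S) (introT andP (conj c1 c2)).
have [x [/andP[ax xb] Qx] xc] := sup_adherent r0 hS.
have xS : x <= sup S by apply: sup_upper_bound => //; split=> //; rewrite ax.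
have bS : b <= sup S.
  rewrite leNgt; apply/negP => Sb.
  (* If [sup S < b], this point lies beyond the supremum, yet [key] puts it in [S]. *)
  pose y := Num.min b (sup S + r / 2).
  have yS : y <= sup S.
    apply: sup_upper_bound => //; split.
      by rewrite ge_min lexx /= le_min (le_trans ax xb) /=; lra.
    apply: (H x) => //; first by rewrite le_min; lra.
    by rewrite gt_min; apply/orP; right; lra.
  by move: yS; rewrite ge_min; apply/negP; rewrite negb_or -!ltNge; lra.
have [l [l1 l2 l3 l4]] : Q b by apply: (H x) => //; lra.
apply: (le_trans l4); rewrite lerD2l; apply/ltW/acd => //.
rewrite -lte_fin; apply: le_lt_trans l3 _; apply: le_lt_trans mUd.
apply: le_measure; rewrite ?inE //; exact: measurableI.
Qed.

End absolute_continuity.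

(** * Sums and products of absolutely continuous functions *)

Section ac_products.
Context {R : realType}.
Implicit Types (a b : R) (f g : R -> R).

Lemma acD a b f g : abs_cont a b f -> abs_cont a b g -> abs_cont a b (f \+ g).
Proof.
move=> acf acg e e0; have e2 : 0 < e / 2 by rewrite divr_gt0.
have [d1 d10 H1] := acf _ e2; have [d2 d20 H2] := acg _ e2.
exists (Num.min d1 d2); first by rewrite lt_min d10.
move=> n s t st dis; rewrite lt_min => /andP[sd1 sd2].
have := ltrD (H1 _ _ _ st dis sd1) (H2 _ _ _ st dis sd2).
rewrite -splitr -big_split /=; apply: le_lt_trans; apply: ler_sum => i _.
by rewrite opprD addrACA ler_normD.
Qed.

Lemma ac_bounded a b f : a <= b -> abs_cont a b f ->
  exists2 M, 0 <= M & forall x, a <= x <= b -> `|f x| <= M.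
Proof.
move=> ab acf.
have cf : {within `[a, b], continuous f}.
  apply/subspace_continuousP => x /=; rewrite in_itv /= => /andP[ax xb].
  apply/cvgrPdist_lt => e e0; have [d d0 H] := acf _ e0.
  rewrite near_withinE; exists d => //= y; rewrite /ball_ /= => yd.
  rewrite in_itv /= => /andP[ay yb].
  have [xy|yx] := leP x y.
    (* A family of one interval turns absolute continuity into continuity; its endpoints must be
       ordered, hence the two cases. *)
    have := H 1 (fun=> x) (fun=> y) (fun=> And3 ax xy yb).
    rewrite !big_ord1 distrC; apply => //.
      by move=> i j _ _ _; rewrite !ord1.
    by rewrite distrC ger0_norm // in yd; lra.
  have := H 1 (fun=> y) (fun=> x) (fun=> And3 ay (ltW yx) xb).
  rewrite !big_ord1; apply => //.
    by move=> i j _ _ _; rewrite !ord1.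
  by rewrite gtr0_norm // in yd; lra.
have cf' : {within `[a, b], continuous (fun x => `|f x|)}.
  by move=> x; apply: continuous_comp; [exact: cf | exact: norm_continuous].
have [c _ H] := EVT_max ab cf'.
by exists `|f c| => // x xab; apply: H; rewrite in_itv.
Qed.

Lemma lipschitz_ac a b f L : 0 <= L -> (forall s t, a <= s -> s <= t -> t <= b ->
  `|f t - f s| <= L * (t - s)) -> abs_cont a b f.
Proof.
move=> L0 fL e e0; exists (e / (L + 1)); first by rewrite divr_gt0 //; lra.
move=> n s t st _ std; apply: (@le_lt_trans _ _ (\sum_(i < n) L * (t i - s i))).
  by apply: ler_sum => i _; have [? ? ?] := st i; exact: fL.
rewrite -mulr_sumr.
have s0 : 0 <= \sum_(i < n) (t i - s i).
  by apply: sumr_ge0 => i _; have [_ ? _] := st i; rewrite subr_ge0.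
move: std; rewrite ltr_pdivlMr; last lra.
move=> h; apply: le_lt_trans h; rewrite mulrC; apply: ler_wpM2l => //; lra.
Qed.

Lemma acM a b f g : a <= b -> abs_cont a b f -> abs_cont a b g -> abs_cont a b (f \* g).
Proof.
move=> ab acf acg.
have [F F0 HF] := ac_bounded ab acf; have [G G0 HG] := ac_bounded ab acg.
move=> e e0.
(* The added 1 keeps the divisor positive when both bounds vanish, and makes the final inequality
   strict. *)
have eG : 0 < e / (F + G + 1) by rewrite divr_gt0 //; lra.
have [d d0 H] : exists2 d, 0 < d & forall n (s t : 'I_n -> R),
    (forall i, [/\ a <= s i, s i <= t i & t i <= b]) ->
    trivIset setT (fun i => `]s i, t i[%classic) ->
    \sum_(i < n) (t i - s i) < d ->
    \sum_(i < n) `|f (t i) - f (s i)| < e / (F + G + 1) /\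
    \sum_(i < n) `|g (t i) - g (s i)| < e / (F + G + 1).
  have [d1 d10 H1] := acf _ eG; have [d2 d20 H2] := acg _ eG.
  exists (Num.min d1 d2); first by rewrite lt_min d10.
  by move=> n s t st dis; rewrite lt_min => /andP[sd1 sd2]; split; [exact: H1|exact: H2].
exists d => // n s t st dis std; have [H1 H2] := H _ _ _ st dis std.
apply: (@le_lt_trans _ _ (\sum_(i < n)
    (G * `|f (t i) - f (s i)| + F * `|g (t i) - g (s i)|))).
  apply: ler_sum => i _; have [asi sti tbi] := st i.
  have -> : (f \* g) (t i) - (f \* g) (s i) =
    (f (t i) - f (s i)) * g (t i) + f (s i) * (g (t i) - g (s i)).
    by rewrite /=; ring.
  apply: (le_trans (ler_normD _ _)); rewrite !normrM; apply: lerD.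
    rewrite mulrC; apply: ler_wpM2r => //; apply: HG; rewrite tbi andbT.
    exact: le_trans asi sti.
  by apply: ler_wpM2r => //; apply: HF; rewrite asi (le_trans sti).
rewrite big_split /= -!mulr_sumr.
have E : e / (F + G + 1) * (F + G + 1) = e by rewrite mulfVK //; apply/lt0r_neq0; lra.
have := ler_wpM2l G0 (ltW H1); have := ler_wpM2l F0 (ltW H2).
move: eG E; set k := _ / _ => k0 kE; set S1 := \sum_(i < n) _; set S2 := \sum_(i < n) _.
by move=> h1 h2; nra.
Qed.

Definition C1pos g (dg : R -> R) := forall x : R, 0 < x ->
  is_derive x 1 g (dg x) /\ {for x, continuous dg}.

Lemma is_derive_continuous g (x dg : R) : is_derive x 1 g dg -> {for x, continuous g}.
Proof. by move=> [+ _] => /derivable1_diffP /differentiable_continuous. Qed.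

(** The maximum of [|dg|] on the compact interval is a Lipschitz constant, by the mean value
    theorem. *)
Lemma C1pos_ac g dg a b : C1pos g dg -> 0 < a -> a <= b -> abs_cont a b g.
Proof.
move=> H a0 ab.
have cf : {within `[a, b], continuous (fun x => `|dg x|)}.
  apply: continuous_in_subspaceT => x; rewrite inE /= in_itv /= => /andP[ax _].
  apply: continuous_comp; last exact: norm_continuous.
  by have [] := H x (lt_le_trans a0 ax).
have [c _ M] := EVT_max ab cf.
apply: (@lipschitz_ac _ _ _ `|dg c|) => // s t as_ st tb.
have [x|x|x + ->] := @MVT_segment _ g dg s t st.
- rewrite in_itv /= => /andP[sx _]; have [] // := H x (lt_trans (lt_le_trans a0 as_) sx).
- apply: continuous_in_subspaceT => y; rewrite inE /= in_itv /= => /andP[sy _].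
  have [+ _] := H y (lt_le_trans a0 (le_trans as_ sy)); exact: is_derive_continuous.
rewrite in_itv /= => /andP[sx xt]; rewrite normrM.
rewrite (ger0_norm (_ : 0 <= t - s)) ?subr_ge0 //.
apply: ler_wpM2r; first by rewrite subr_ge0.
by apply: M; rewrite in_itv /= (le_trans as_ sx) (le_trans xt tb).
Qed.

(** Serves twice, with [f1], [f2] the components of an eigenfunction, which are only absolutely
    continuous, and [g1], [g2] built from [zeta]: for the Wronskian, then for the proportionality
    factor. *)
Lemma ac_combination_cst f1 f2 df1 df2 g1 g2 dg1 dg2 (N : set R) :
  (forall a b, 0 < a -> a <= b -> abs_cont a b f1) ->
  (forall a b, 0 < a -> a <= b -> abs_cont a b f2) ->
  C1pos g1 dg1 -> C1pos g2 dg2 ->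
  (@lebesgue_measure R).-negligible N ->
  (forall x : R, 0 < x -> ~ N x ->
    is_derive x 1 f1 (df1 x) /\ is_derive x 1 f2 (df2 x)) ->
  (forall x, 0 < x -> ~ N x ->
    f1 x * dg1 x + g1 x * df1 x + (f2 x * dg2 x + g2 x * df2 x) = 0) ->
  forall x y, 0 < x -> 0 < y -> f1 x * g1 x + f2 x * g2 x = f1 y * g1 y + f2 y * g2 y.
Proof.
move=> ac1 ac2 C1 C2 N0 df d0 x y x0 y0.
wlog xy : x y x0 y0 / x <= y.
  by move=> H; have [xy|/ltW yx] := leP x y; [|apply/esym]; exact: H.
apply/esym.
apply: (@ac_derive0_cst _ x y ((f1 \* g1) \+ (f2 \* g2)) N) => //.
  apply: acD; apply: acM => //; [exact: ac1|exact: C1pos_ac C1 _ _|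
    exact: ac2|exact: C1pos_ac C2 _ _].
move=> t /andP[xt _] Nt; have t0 := lt_le_trans x0 xt.
have [D1 D2] := df _ t0 Nt; have [E1 _] := C1 _ t0; have [E2 _] := C2 _ t0.
have := is_deriveD (is_deriveM D1 E1) (is_deriveM D2 E2).
by rewrite /GRing.scale /= d0.
Qed.

End ac_products.

(** * The system in coordinates *)

Section planar_system.
Context {R : realType}.
Implicit Types (P : R -> 'M[R]_2) (z : R -> 'cV[R]_2) (lambda : R).

Lemma lift01 : lift ord0 ord0 = 1 :> 'I_2. Proof. exact/val_inj. Qed.

Lemma mulmx2E n (A : 'M[R]_(n, 2)) (w : 'cV[R]_2) i :
  (A *m w) i 0 = A i 0 * w 0 0 + A i 1 * w 1 0.
Proof. by rewrite mxE big_ord_recl big_ord1 lift01. Qed.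

(** Row 1 of the equation gives the derivative of the first component and row 0 that of the second.
    Being pointwise, this serves both genuine solutions and equations valid almost everywhere. *)
Lemma solution_components P lambda z (x : R) :
  derivable z x 1 -> tau P z x = lambda *: z x ->
  is_derive x 1 (fun t => z t 0 0)
    (P x 1 0 * z x 0 0 + (P x 1 1 - lambda) * z x 1 0) /\
  is_derive x 1 (fun t => z t 1 0)
    ((lambda - P x 0 0) * z x 0 0 - P x 0 1 * z x 1 0).
Proof.
move=> dz; rewrite /tau derive1E derive_mx // => /matrixP E.
have D i j := (derivable_mxP z x 1).1 dz i j.
have {}E i : (Jmx R *m \matrix_(i < 2, j < 1) 'D_1 (fun t => z t i j) x) i 0 +
    (P x *m z x) i 0 = lambda * z x i 0.
  by have := E i 0; rewrite mxE => ->; rewrite mxE.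
move: (E 0) (E 1); rewrite !mulmx2E !mxE /= => E0 E1.
split; (split; [exact: D|lra]).
Qed.

Lemma ac_component z a b i : abs_continuous a b z -> abs_cont a b (fun t => z t i 0).
Proof.
move=> acz e e0; have [d d0 H] := acz e e0; exists d => // n s t st dis std.
apply: le_lt_trans (H _ _ _ st dis std); apply: ler_sum => j _.
rewrite [leRHS]/Num.Def.normr /= mx_normrE.
apply: le_trans; last exact: (le_bigmax _ _ (i, 0)).
by rewrite !mxE.
Qed.

End planar_system.

(** * Growth near 0 of a solution with limit angle [ts] *)

Section near_zero.
Context {R : realType}.
Implicit Types (P : R -> 'M[R]_2) (z : R -> 'cV[R]_2) (lambda : R).

Definition sqrad z (x : R) := z x 0 0 ^+ 2 + z x 1 0 ^+ 2.

(** This is [<J M e, e>] for the unit vector [e] of angle [t]. As [J] is skew, adding a multiple of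
    the identity to [M] does not change it, so [lambda] drops out. *)
Definition radial (M : 'M[R]_2) (t : R) :=
  cos t * (M 1 0 * cos t + M 1 1 * sin t) -
  sin t * (M 0 0 * cos t + M 0 1 * sin t).

Lemma radialZ (a : R) (M : 'M[R]_2) (t : R) : radial (a *: M) t = a * radial M t.
Proof. by rewrite /radial !mxE; ring. Qed.

(** With [s] the square root, the eigenvector equation reads [Pstar e = - s J e]; since [J^2 = -1],
    this gives [J Pstar e = s e]. *)
Lemma radial_theta_star (Pstar : 'M[R]_2) (t : R) :
  is_theta_star Pstar t -> radial Pstar t = Num.sqrt (- \det Pstar).
Proof.
move=> [_ _ [w [w0 Ew [c wc]]]].
have c0 : c != 0 by apply: contraNneq w0 => c0; rewrite wc c0 scale0r.
have uJ : Jmx R \in unitmx.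
  have /mulmx1_unit[] // : Jmx R *m (- Jmx R) = 1%:M.
  apply/matrixP => i j; rewrite mxE big_ord_recl big_ord1 lift01 !mxE /=.
  by case: i => [[|[]]] // i; case: j => [[|[]]] // j; rewrite /= ?eqxx; ring.
have {}Ew : Pstar *m w = (- Num.sqrt (- \det Pstar)) *: (Jmx R *m w).
  by rewrite scalemxAr -Ew -mulmxA mulKVmx.
move: Ew; set s := Num.sqrt _ => /matrixP Ew.
have E i : (Pstar *m w) i 0 = - s * (Jmx R *m w) i 0 by rewrite Ew mxE.
move: (E 0) (E 1); rewrite !mulmx2E wc !mxE /= => E0 E1.
have F0 : Pstar 0 0 * cos t + Pstar 0 1 * sin t = - s * sin t.
  by apply: (mulfI c0); lra.
have F1 : Pstar 1 0 * cos t + Pstar 1 1 * sin t = s * cos t.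
  by apply: (mulfI c0); rewrite mulrDr !(mulrCA c) E1; ring.
rewrite /radial F0 F1; 
have -> : cos t * (s * cos t) - sin t * (- s * sin t) =
  s * (cos t ^+ 2 + sin t ^+ 2) by ring.
by rewrite cos2Dsin2 mulr1.
Qed.

Lemma radial_cvg (M : R -> 'M[R]_2) (t : R -> R) M0 t0 (F : set_system R) :
  Filter F -> M @ F --> M0 -> t @ F --> t0 ->
  radial (M x) (t x) @[x --> F] --> radial M0 t0.
Proof.
move=> FF cM ct.
have cMij i j : M x i j @[x --> F] --> M0 i j.
  exact: (cvg_comp _ _ cM (@coord_continuous _ _ _ i j M0)).
have cc : cos (t x) @[x --> F] --> cos t0.
  exact: (cvg_comp _ _ ct (@continuous_cos R t0)).
have cs : sin (t x) @[x --> F] --> sin t0.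
  exact: (cvg_comp _ _ ct (@continuous_sin R t0)).
by apply: cvgB; apply: cvgM => //; apply: cvgD; apply: cvgM.
Qed.

(** For [beta = 1] the limit of the left side is [s > 1/2], because [det Pstar < -1/4]. For
    [beta > 1] the left side is [radial (x^beta P x)], eventually above [s / 2], divided by
    [x^(beta - 1)], eventually at most [s]. *)
Lemma radial_ge_near0 P (beta : R) (Pstar : 'M[R]_2) (ts : R) (phi : R -> R) :
  cond_zero P beta Pstar -> is_theta_star Pstar ts ->
  phi x @[x --> 0^'+] --> ts ->
  \forall x \near 0^'+, 1 / 2 <= x * radial (P x) (phi x).
Proof.
move=> [b1 _ [q0 [_ cP _]] det1 det2] hts cphi.
have := radial_cvg (at_right_proper_filter 0) cP cphi; rewrite (radial_theta_star hts).
set s := Num.sqrt _ => cq.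
move: b1; rewrite le_eqVlt => /orP[/eqP/esym b1|b1].
  have s12 : 1 / 2 < s.
    have -> : 1 / 2 = Num.sqrt (1 / 4) :> R.
      rewrite (_ : 1 / 4 = (1 / 2) ^+ 2); last by field.
      by rewrite sqrtr_sqr ger0_norm //; lra.
    by rewrite ltr_sqrt; have := det1 b1; lra.
  near=> x.
  have x0 : 0 < x by near: x; exact: nbhs_right_gt.
  have : 1 / 2 < radial (x `^ beta *: P x) (phi x).
    by near: x; exact: (cvgr_gt _ cq).
  by rewrite radialZ b1 (powRr1 (ltW x0)) => /ltW.
have s0 : 0 < s by rewrite sqrtr_gt0; have := det2 b1; lra.
(* The point at which [x^(beta - 1)] reaches [s]. *)
pose eta := s `^ (beta - 1)^-1.
have b0 : 0 < beta - 1 by lra.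
near=> x.
have x0 : 0 < x by near: x; exact: nbhs_right_gt.
have : s / 2 < radial (x `^ beta *: P x) (phi x).
  by near: x; apply: (cvgr_gt _ cq); lra.
have xeta : x < eta by near: x; apply: nbhs_right_lt; exact: powR_gt0.
have : x `^ (beta - 1) <= s.
  have -> : s = eta `^ (beta - 1).
    by rewrite -powRrM mulVf ?gt_eqF // powRr1 // ltW.
  by apply: ge0_ler_powR; rewrite ?nnegrE ?powR_ge0 // ltW.
have y0 := powR_gt0 (beta - 1) x0.
rewrite radialZ -(@mulr_powRB1 _ x beta (ltW x0)); last lra.
move: y0; set y := x `^ _ => y0 ys; rewrite -mulrA mulrCA; set r := x * _ => h.
rewrite leNgt; apply/negP => r12.
have := ltr_pM2l y0 r (1 / 2); rewrite r12; lra.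
Unshelve. all: by end_near. Qed.

(** From [z' = J (P - lambda) z] and [<J z, z> = 0]; the angle enters through [z = rho e]. *)
Lemma sqrad_derive P lambda z phi (x : R) :
  ode_solution P lambda z -> angular z phi -> 0 < x ->
  is_derive x 1 (sqrad z) (2 * sqrad z x * radial (P x) (phi x)).
Proof.
move=> sol [_ ang] x0.
have [dz tz] := sol _ x0; have [D0 D1] := solution_components dz tz.
have [rho rho0 zE] := ang _ x0.
have := is_deriveD (is_deriveM D0 D0) (is_deriveM D1 D1).
rewrite /GRing.scale /=; set d := (X in is_derive _ _ _ X).
have -> : 2 * sqrad z x * radial (P x) (phi x) = d.
  have cs := cos2Dsin2 (phi x).
  rewrite /d /sqrad /radial zE !mxE /=; set c := cos _ in cs *; set s := sin _ in cs *.
  rewrite !exprMn -mulrDr cs; ring.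
by have -> : sqrad z = (fun t => z t 0 0) * (fun t => z t 0 0) +
    (fun t => z t 1 0) * (fun t => z t 1 0)
  by apply/funext => t; rewrite /sqrad !expr2.
Qed.

Lemma sqrad_gt0 z phi (x : R) : angular z phi -> 0 < x -> 0 < sqrad z x.
Proof.
move=> [_ ang] x0; have [rho rho0 zE] := ang _ x0.
by rewrite /sqrad zE !mxE /= !exprMn -mulrDr cos2Dsin2 mulr1 exprn_gt0.
Qed.

(* Near [0] the logarithmic derivative of [|z|^2] is at least [1 / x], so that
   [|z|^2 / x] is nondecreasing. *)
Lemma sqrad_le_linear P (beta lambda : R) (Pstar : 'M[R]_2) (ts : R) z phi :
  cond_zero P beta Pstar -> is_theta_star Pstar ts ->
  ode_solution P lambda z -> angular z phi -> phi x @[x --> 0^'+] --> ts ->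
  exists C d, [/\ 0 < C, 0 < d & forall x, 0 < x <= d -> sqrad z x <= C * x].
Proof.
move=> c0 hts sol ang cphi.
have [e /= e0 H] := radial_ge_near0 c0 hts cphi.
pose d := e / 2; have d0 : 0 < d by rewrite divr_gt0.
pose h (x : R) := sqrad z x * x^-1.
have dh (x : R) : 0 < x -> is_derive x 1 h
    (sqrad z x * (- x ^- 2) + x^-1 * (2 * sqrad z x * radial (P x) (phi x))).
  move=> x0.
  have := is_deriveM (sqrad_derive sol ang x0)
    (is_deriveV (lt0r_neq0 x0) (is_derive_id x 1)).
  by rewrite /GRing.scale /= mulr1.
have hh x y : 0 < x -> x <= y -> y <= d -> h x <= h y.
  move=> x0 xy yd.
  apply: (@ger0_derive1_ndecr R h x d) => //.
  - by move=> t; rewrite in_itv /= => /andP[xt _]; have [] := dh t (lt_trans x0 xt).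
  - move=> t; rewrite in_itv /= => /andP[xt td]; have t0 := lt_trans x0 xt.
    have dt := dh t t0; rewrite derive1E derive_val.
    have : 1 / 2 <= t * radial (P t) (phi t).
      by apply: H => //; rewrite /ball_ /= sub0r normrN gtr0_norm // /d in td *; lra.
    have := sqrad_gt0 ang t0; set r := radial _ _; set D := sqrad z t => D0 tr.
    have -> : D * - t ^- 2 + t^-1 * (2 * D * r) = (2 * D / t ^+ 2) * (t * r - 1 / 2).
      by field; rewrite gt_eqF.
    by apply: mulr_ge0; [rewrite divr_ge0 ?exprn_ge0 ?ltW //; lra|lra].
  - apply: continuous_in_subspaceT => t; rewrite inE /= in_itv /= => /andP[xt _].
    exact: is_derive_continuous (dh t (lt_le_trans x0 xt)).
exists (h d), d; split => //; first by rewrite /h divr_gt0 // (sqrad_gt0 ang).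
move=> x /andP[x0 xd]; rewrite -ler_pdivrMr //; exact: hh.
Qed.

End near_zero.

(** * Eigenfunctions are multiples of [zeta] *)

Section eigenfunctions.
Context {R : realType}.
Implicit Types (P : R -> 'M[R]_2) (z : R -> 'cV[R]_2) (lambda : R).

(** The integral of [K / x] over [[e, d]] is [K (ln d - ln e)], unbounded as [e] tends to 0, while
    the integral of [|z|^2] is finite. *)
Lemma L2_sqrad_not_ge_inv z (K d : R) : L2 z -> 0 < K -> 0 < d ->
  ~ (forall x, 0 < x <= d -> K / x <= sqrad z x).
Proof.
move=> Lz K0 d0 H.
pose mu := @lebesgue_measure R.
pose f (x : R) := (sqrad z x)%:E.
have mz i : measurable_fun (`]0%R, +oo[%classic : set R)
    (EFin \o (fun x => z x i 0 ^+ 2)).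
  apply/measurable_EFinP.
  by apply: measurable_funX; have [] := Lz i.
have mf : measurable_fun (`]0%R, +oo[%classic : set R) f.
  apply/measurable_EFinP.
  rewrite -[X in measurable_fun _ X]/((fun x => z x 0 0 ^+ 2) \+ (fun x => z x 1 0 ^+ 2)).
  by apply: measurable_funD; exact/measurable_EFinP.
have foo : (\int[mu]_(x in `]0%R, +oo[) f x < +oo)%E.
  have -> : (\int[mu]_(x in `]0%R, +oo[) f x =
    \int[mu]_(x in `]0%R, +oo[) ((z x 0 0 ^+ 2)%:E + (z x 1 0 ^+ 2)%:E))%E by [].
  rewrite ge0_integralD //.
  - by apply: lte_add_pinfty; [have [] := Lz 0|have [] := Lz 1].
  - by move=> x ?; rewrite lee_fin sqr_ge0.
  - exact: mz.
  - by move=> x ?; rewrite lee_fin sqr_ge0.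
  - exact: mz.
have f0 x : (0 <= f x)%E by rewrite lee_fin addr_ge0 // sqr_ge0.
have key e : 0 < e -> e < d ->
    ((K * (ln d - ln e))%:E <= \int[mu]_(x in `]0%R, +oo[) f x)%E.
  move=> e0 ed.
  apply: (@le_trans _ _ (\int[mu]_(x in `[e, d]) f x)%E); last first.
    apply: ge0_subset_integral => //.
    by move=> x /=; rewrite !in_itv /= andbT => /andP[+ _]; exact: lt_le_trans.
  have cK : {within `[e, d], continuous (fun x : R => K / x)}.
    apply: continuous_in_subspaceT => x; rewrite inE /= in_itv /= => /andP[ex _].
    apply: cvgM; first exact: cvg_cst.
    by apply: cvgV; [rewrite gt_eqF // (lt_le_trans e0)|exact: cvg_id].
  have -> : (K * (ln d - ln e))%:E = (\int[mu]_(x in `[e, d]) (K / x)%:E)%E.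
    have dln (x : R) : 0 < x -> is_derive x 1 (fun t => K * ln t) (K / x).
      by move=> x0; have := is_deriveZ K (is_derive1_ln x0).
    have cln (x : R) : 0 < x -> {for x, continuous (fun t => K * ln t)}.
      by move=> x0; exact: is_derive_continuous (dln x x0).
    rewrite (@continuous_FTC2 _ _ (fun x => K * ln x)) //.
    - by rewrite -EFinB mulrBr.
    - split.
      + by move=> x; rewrite in_itv /= => /andP[ex _]; have [] := dln x (lt_trans e0 ex).
      + exact: cvg_at_right_filter (cln e e0).
      + exact: cvg_at_left_filter (cln d d0).
    - move=> x; rewrite in_itv /= => /andP[ex _]; have dx := dln x (lt_trans e0 ex).
      by rewrite derive1E derive_val.
  apply: ge0_le_integral => //.
  - move=> x /=; rewrite in_itv /= => /andP[ex _]; rewrite lee_fin divr_ge0 ?ltW //.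
    exact: lt_le_trans ex.
  - apply/measurable_EFinP.
    exact: subspace_continuous_measurable_fun.
  - apply: measurable_funS mf => //.
    by move=> x /=; rewrite !in_itv /= andbT => /andP[+ _]; exact: lt_le_trans.
  - move=> x /=; rewrite in_itv /= => /andP[ex xd]; rewrite lee_fin; apply: H.
    by rewrite xd andbT (lt_le_trans e0).
have fin : (\int[mu]_(x in `]0%R, +oo[) f x)%E \is a fin_num.
  by rewrite ge0_fin_numE //; apply: integral_ge0 => x _.
move: key; rewrite -(fineK fin); set B := fine _ => key.
have B0 : 0 <= B by rewrite fine_ge0 //; apply: integral_ge0 => x _.
(* Chosen so that [K (ln d - ln e) = B + 1], which exceeds the integral [B]. *)
pose e := d * expR (- ((B + 1) / K)).
have e0 : 0 < e by rewrite mulr_gt0 // expR_gt0.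
have ed : e < d.
  by rewrite -[ltRHS]mulr1 ltr_pM2l // expR_lt1 oppr_lt0 divr_gt0 //; lra.
have le : ln e = ln d - (B + 1) / K by rewrite lnM ?posrE ?expR_gt0 // expRK.
have := key e e0 ed; rewrite lee_fin le subKr mulrC mulfVK ?gt_eqF //; lra.
Qed.

Lemma ode_C1pos P lambda z : {within `]0, +oo[, continuous P} ->
  ode_solution P lambda z ->
  C1pos (fun t => z t 0 0)
    (fun x => P x 1 0 * z x 0 0 + (P x 1 1 - lambda) * z x 1 0) /\
  C1pos (fun t => z t 1 0)
    (fun x => (lambda - P x 0 0) * z x 0 0 - P x 0 1 * z x 1 0).
Proof.
move=> cP sol.
have cPij i j (x : R) : 0 < x -> {for x, continuous (fun t => P t i j)}.
  move=> x0; have cx : {for x, continuous P}.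
    move: cP; rewrite continuous_open_subspace; last exact: interval_open.
    by apply; rewrite inE /= in_itv /= x0.
  exact: (cvg_comp _ _ cx (@coord_continuous _ _ _ i j (P x))).
have D (x : R) (x0 : 0 < x) := solution_components (proj1 (sol x x0)) (proj2 (sol x x0)).
have c0 (x : R) (x0 : 0 < x) := is_derive_continuous (proj1 (D x x0)).
have c1 (x : R) (x0 : 0 < x) := is_derive_continuous (proj2 (D x x0)).
split=> x x0; (split; [by have [] := D x x0|]).
- apply: cvgD; apply: cvgM; [exact: cPij|exact: c0| |exact: c1].
  by apply: cvgB; [exact: cPij|exact: cvg_cst].
- apply: cvgB; apply: cvgM; [|exact: c0|exact: cPij|exact: c1].
  by apply: cvgB; [exact: cvg_cst|exact: cPij].
Qed.


Lemma eigenfunction_proportional P (mum mup beta ts lambda : R) (Pstar : 'M[R]_2)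
    z zeta phi :
  class_P mum mup P -> cond_zero P beta Pstar -> is_theta_star Pstar ts ->
  eigenfunction P lambda z ->
  ode_solution P lambda zeta -> angular zeta phi -> phi x @[x --> 0^'+] --> ts ->
  exists2 k, k != 0 & forall x, 0 < x -> z x = k *: zeta x.
Proof.
move=> [cP symP _ _] c0 hts [[Lz acz _] [x0 x00 zx0] zae] sol ang cphi.
have sP (x : R) : 0 < x -> P x 0 1 = P x 1 0.
  by move=> /symP /matrixP /(_ 1 0); rewrite mxE.
have [C0 C1] := ode_C1pos cP sol.
have ac_z i a b : 0 < a -> a <= b -> abs_cont a b (fun t => z t i 0).
  by move=> a0 ab; apply: ac_component; exact: acz.
have dz (x : R) : 0 < x ->
    ~ (~` [set x : R | 0 < x -> derivable z x 1 /\ tau P z x = lambda *: z x]) x ->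
    is_derive x 1 (fun t => z t 0 0)
      (P x 1 0 * z x 0 0 + (P x 1 1 - lambda) * z x 1 0) /\
    is_derive x 1 (fun t => z t 1 0)
      ((lambda - P x 0 0) * z x 0 0 - P x 0 1 * z x 1 0).
  move=> xp /contrapT /(_ xp) [d t]; exact: solution_components.
have zeta_gt0 (x : R) : 0 < x -> 0 < sqrad zeta x := sqrad_gt0 ang.
pose W x := z x 0 0 * zeta x 1 0 - z x 1 0 * zeta x 0 0.
(* The derivative of [W] given by the product rule cancels off the null set because the system has
   trace [P 1 0 - P 0 1], zero by symmetry. *)
have Wcst x y : 0 < x -> 0 < y -> W x = W y.
  move=> xp yp; have CN : C1pos (fun t => - zeta t 0 0)
      (fun x => - (P x 1 0 * zeta x 0 0 + (P x 1 1 - lambda) * zeta x 1 0)).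
    move=> t tp; have [dt ct] := C0 t tp.
    by split; [exact: (is_deriveN dt) | exact: cvgN].
  have := ac_combination_cst (ac_z 0) (ac_z 1) C1 CN zae dz _ xp yp.
  rewrite /W !mulrN; apply => t tp _; rewrite (sP t tp); ring.
have W0 x : 0 < x -> W x = 0.
  move=> xp; apply/eqP/negP => /negP Wx.
  have [C [d [Cp dp H]]] := sqrad_le_linear c0 hts sol ang cphi.
  apply: (@L2_sqrad_not_ge_inv z (W x ^+ 2 / C) d) => //.
    by rewrite divr_gt0 // exprn_even_gt0.
  move=> y /andP[yp yd]; have Dp := zeta_gt0 y yp.
  have Dle : sqrad zeta y <= C * y by apply: H; rewrite yp.
  rewrite (Wcst x y xp yp) -mulrA -invfM ler_pdivrMr ?mulr_gt0 //.
  apply: (@le_trans _ _ (sqrad z y * sqrad zeta y)); last first.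
    by apply: ler_wpM2l => //; rewrite addr_ge0 // sqr_ge0.
  (* Lagrange's identity, whence the bound of [W^2] by the product of the squared norms. *)
  have -> : sqrad z y * sqrad zeta y =
      W y ^+ 2 + (z y 0 0 * zeta y 0 0 + z y 1 0 * zeta y 1 0) ^+ 2.
    by rewrite /sqrad /W; ring.
  by rewrite lerDl sqr_ge0.
(* The projection coefficient [<z, zeta> / |zeta|^2], written as a sum of products with the
   components of [z] as first factors so that [ac_combination_cst] applies. *)
pose c x := z x 0 0 * (zeta x 0 0 / sqrad zeta x) +
            z x 1 0 * (zeta x 1 0 / sqrad zeta x).
have zc0 x : 0 < x -> z x 0 0 = c x * zeta x 0 0.
  move=> xp; have := zeta_gt0 x xp; have := W0 x xp; rewrite /W /c /sqrad => Wx Dp.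
  set D := zeta x 0 0 ^+ 2 + _ in Dp *.
  apply: (mulIf (lt0r_neq0 Dp)).
  have -> : (z x 0 0 * (zeta x 0 0 / D) + z x 1 0 * (zeta x 1 0 / D)) * zeta x 0 0 * D =
    (z x 0 0 * zeta x 0 0 + z x 1 0 * zeta x 1 0) * zeta x 0 0.
    by field; rewrite gt_eqF.
  apply/eqP; rewrite -subr_eq0; apply/eqP.
  by transitivity ((z x 0 0 * zeta x 1 0 - z x 1 0 * zeta x 0 0) * zeta x 1 0);
    [rewrite /D; ring | rewrite Wx mul0r].
have zc1 x : 0 < x -> z x 1 0 = c x * zeta x 1 0.
  move=> xp; have := zeta_gt0 x xp; have := W0 x xp; rewrite /W /c /sqrad => Wx Dp.
  set D := zeta x 0 0 ^+ 2 + _ in Dp *.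
  apply: (mulIf (lt0r_neq0 Dp)).
  have -> : (z x 0 0 * (zeta x 0 0 / D) + z x 1 0 * (zeta x 1 0 / D)) * zeta x 1 0 * D =
    (z x 0 0 * zeta x 0 0 + z x 1 0 * zeta x 1 0) * zeta x 1 0.
    by field; rewrite gt_eqF.
  apply/eqP; rewrite -subr_eq0; apply/eqP.
  by transitivity (- (z x 0 0 * zeta x 1 0 - z x 1 0 * zeta x 0 0) * zeta x 0 0);
    [rewrite /D; ring | rewrite Wx oppr0 mul0r].
(* Both functions satisfy the same linear system, so [z = c zeta] gives [z' = c zeta'] almost
   everywhere; substituting this in the derivative of [c] makes it vanish. *)
have ccst x y : 0 < x -> 0 < y -> c x = c y.
  move=> xp yp.
  pose p t := P t 1 0 * zeta t 0 0 + (P t 1 1 - lambda) * zeta t 1 0.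
  pose q t := (lambda - P t 0 0) * zeta t 0 0 - P t 0 1 * zeta t 1 0.
  have cD (t : R) (tp : 0 < t) := is_derive_continuous (sqrad_derive sol ang tp).
  (* The derivative of [|zeta|^2] in Cartesian form: its continuity is visible and no angle enters
     the final computation. *)
  pose D2 t := 2 * (zeta t 0 0 * p t + zeta t 1 0 * q t).
  have dD (t : R) : 0 < t -> is_derive t 1 (sqrad zeta) (D2 t).
    move=> tp; have [d0 _] := C0 t tp; have [d1 _] := C1 t tp.
    have := is_deriveD (is_deriveM d0 d0) (is_deriveM d1 d1).
    rewrite /GRing.scale /= -/(p t) -/(q t); set d := (X in is_derive _ _ _ X).
    have -> : D2 t = d by rewrite /d /D2; ring.
    by rewrite (_ : sqrad zeta = (fun t => zeta t 0 0) * (fun t => zeta t 0 0) +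
      (fun t => zeta t 1 0) * (fun t => zeta t 1 0)) //;
      apply/funext => s; rewrite /sqrad !expr2.
  have Cdiv f df : C1pos f df -> C1pos (fun t => f t / sqrad zeta t)
      (fun t => f t * (- sqrad zeta t ^- 2 * D2 t) + (sqrad zeta t)^-1 * df t).
    move=> Cf t tp; have [dt ct] := Cf t tp; have Dp := zeta_gt0 t tp.
    have [d0 e0] := C0 t tp; have [d1 e1] := C1 t tp.
    have Vt : {for t, continuous (fun x => (sqrad zeta x)^-1)}.
      by apply: cvgV; [rewrite gt_eqF|exact: cD].
    split.
      by have := is_deriveM dt (is_deriveV (lt0r_neq0 Dp) (dD t tp)).
    apply: cvgD; apply: cvgM => //; first exact: is_derive_continuous dt.
    apply: cvgM; first apply: cvgN.
      by apply: cvgV; [rewrite expf_neq0 // gt_eqF |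
        rewrite expr2; apply: cvgM; exact: cD].
    rewrite /D2; apply: cvgM; first exact: cvg_cst.
    by apply: cvgD; apply: cvgM => //;
      [exact: is_derive_continuous d0|exact: is_derive_continuous d1].
  have := ac_combination_cst (ac_z 0) (ac_z 1) (Cdiv _ _ C0) (Cdiv _ _ C1) zae dz _ xp yp.
  apply => t tp _; have Dp := zeta_gt0 t tp.
  rewrite (zc0 t tp) (zc1 t tp) /D2 /p /q; set k := c t.
  set D := sqrad zeta t in Dp *.
  have DE : D = zeta t 0 0 ^+ 2 + zeta t 1 0 ^+ 2 by [].
  move: (zeta t 0 0) (zeta t 1 0) DE => a b DE.
  move: Dp; rewrite DE => Dp; field; rewrite gt_eqF //.
have zc x : 0 < x -> z x = c x0 *: zeta x.
  move=> xp; rewrite (ccst _ _ x00 xp); apply/matrixP => i j; rewrite mxE ord1.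
  have [->|->] : i = 0 \/ i = 1; last exact: zc1; last exact: zc0.
  by case: i => [[|[|]]] // ?; [left|right]; exact/val_inj.
exists (c x0) => //; apply: contra_neq zx0 => ck.
by rewrite (zc _ x00) ck scale0r.
Qed.

End eigenfunctions.

(** * Angles and rotation numbers *)

Section rotation.
Context {R : realType}.
Implicit Types (P : R -> 'M[R]_2) (z : R -> 'cV[R]_2) (lambda : R).

(** The values of [g] are multiples of [pi]; two distinct ones would force, by the intermediate
    value theorem, a value strictly between consecutive multiples. *)
Lemma sin_continuous_cst (g : R -> R) : {within `]0, +oo[, continuous g} ->
  (forall x, 0 < x -> sin (g x) = 0) ->
  forall x y, 0 < x -> 0 < y -> g x = g y.
Proof.
move=> cg g0 x y x0 y0.
wlog xy : x y x0 y0 / x <= y.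
  by move=> H; have [xy|/ltW yx] := leP x y; [|apply/esym]; exact: H.
apply: contrapT => /eqP; set m := Num.min (g x) (g y).
set M := Num.max (g x) (g y) => gxy.
have mM : m < M by rewrite /m /M; case: (ltgtP (g x) (g y)) gxy => // ->; rewrite eqxx.
have sm : sin m = 0 by rewrite /m; case: leP => _; exact: g0.
(* Small enough for [m + t] to stay below [M] and for [sin t] to be positive; then
   [sin (m + t) = cos m * sin t] is nonzero. *)
pose t := Num.min (M - m) (pi / 2).
have t0 : 0 < t by rewrite lt_min subr_gt0 mM /= divr_gt0 // pi_gt0.
have tpi : t < pi.
  by rewrite gt_min; apply/orP; right; have := pi_gt0 R; lra.
have cg' : {within `[x, y], continuous g}.
  apply: continuous_subspaceW cg => s /=; rewrite !in_itv /= andbT => /andP[+ _].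
  exact: lt_le_trans.
have [|s] := @IVT R g x y (m + t) xy cg'.
  rewrite -/m -/M lerDl ltW //= -lerBrDl ge_min lexx //.
rewrite in_itv /= => /andP[xs _] gs.
have := g0 s (lt_le_trans x0 xs); rewrite gs sinD sm mul0r add0r => /eqP.
rewrite mulf_eq0 => /orP[/eqP cm|/eqP st].
  by have := cos2Dsin2 m; rewrite cm sm expr0n /= addr0 => /eqP; rewrite eq_sym oner_eq0.
by have := sin_gt0_pi (introT andP (conj t0 tpi)); rewrite st ltxx.
Qed.

(** Parallel vectors make the sine of the difference of the angles vanish, so this continuous
    difference is constant. *)
Lemma angular_scale z zeta k theta phi : (forall x, 0 < x -> z x = k *: zeta x) ->
  angular z theta -> angular zeta phi ->
  exists m, forall x, 0 < x -> theta x = phi x + m.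
Proof.
move=> zk [ct at_] [cp ap].
have cd : {within `]0, +oo[, continuous (theta \- phi)}.
  by move=> x; apply: continuousB; [exact: ct|exact: cp].
have sd x : 0 < x -> sin ((theta \- phi) x) = 0.
  move=> x0; have [r r0 zr] := at_ x x0; have [s s0 zs] := ap x x0.
  have := zk x x0; rewrite zr zs => /matrixP E.
  move: (E 0 0) (E 1 0); rewrite !mxE /= => E0 E1.
  apply: (mulfI (lt0r_neq0 r0)); rewrite mulr0 /= sinB.
  have -> : r * (sin (theta x) * cos (phi x) - cos (theta x) * sin (phi x)) =
    (r * sin (theta x)) * cos (phi x) - (r * cos (theta x)) * sin (phi x) by ring.
  by rewrite E0 E1; ring.
exists (theta 1 - phi 1) => x x0.
have /= := sin_continuous_cst cd sd x0 ltr01; lra.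
Qed.

(** A negative [k] turns the vector by [pi], since the radius must stay positive. *)
Lemma angular_exists z zeta k phi : k != 0 -> (forall x, 0 < x -> z x = k *: zeta x) ->
  angular zeta phi -> exists m, angular z (fun x => phi x + m).
Proof.
move=> k0 zk [cp ap].
have cm m : {within `]0, +oo[, continuous (fun x => phi x + m)}.
  by move=> x; apply: continuousD; [exact: cp|exact: cvg_cst].
have [kn|kp] := ltP k 0.
  exists pi; split => // x x0; have [s s0 zs] := ap x x0.
  exists (- k * s); first by rewrite mulr_gt0 // oppr_gt0.
  rewrite (zk x x0) zs cosDpi sinDpi; apply/matrixP => i j; rewrite !mxE.
  by case: ifP => _; ring.
exists 0; split => // x x0; have [s s0 zs] := ap x x0.
exists (k * s); first by rewrite mulr_gt0 // lt0r k0.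
by rewrite addr0 (zk x x0) zs scalerA.
Qed.

Lemma shift_limit (F : set_system R) (theta phi : R -> R) (m a b : R) :
  ProperFilter F -> (\forall x \near F, theta x = phi x + m) ->
  theta @ F --> a -> phi @ F --> b -> a = b + m.
Proof.
move=> FF E ca cb.
apply: (@norm_cvg_unique _ _ (theta @ F)) => //=.
have : (fun x => phi x + m) @ F --> b + m by apply: cvgD => //; exact: cvg_cst.
apply: cvg_trans; apply: near_eq_cvg.
by apply: filterS E => x ->.
Qed.

(** The constant shift between the angles of [z] and [zeta] cancels in the difference of the limits,
    leaving [nu - ts], and [nu = k pi + pi - alpha] by the choice of [lambda]. *)
Lemma eigenfunction_rot P (mum mup beta ts lambda : R) (Pstar : 'M[R]_2) (k : int) z :
  class_P mum mup P -> cond_zero P beta Pstar -> is_theta_star Pstar ts ->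
  is_lambda P mum mup ts k lambda -> eigenfunction P lambda z ->
  exists alpha, [/\ 0 < alpha < pi / 2, exists r, is_rot z r &
    forall r, is_rot z r -> r * pi = k%:~R * pi + pi - alpha - ts].
Proof.
move=> HP c0 hts [l1 l2 [nu [phi [zeta [[sol _ _] ang cphi]] cnu] nuE]] eig.
exists (atan (Num.sqrt ((lambda - mum) / (mup - lambda)))).
have pi0 := pi_gt0 R.
have [K K0 zK] := eigenfunction_proportional HP c0 hts eig sol ang cphi.
split.
- rewrite atan_ltpi2 andbT -[X in X < _](@atan0 R); apply: lt_atan.
  by rewrite sqrtr_gt0 divr_gt0 // subr_gt0.
- have [m am] := angular_exists K0 zK ang.
  exists ((nu + m - (ts + m)) / pi), (fun x => phi x + m), (ts + m), (nu + m).
  by split => //; apply: cvgD => //; exact: cvg_cst.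
- move=> r [theta [th0 [thoo [at_ ct0 ctoo rE]]]].
  have [m thE] := angular_scale zK at_ ang.
  have E0 : th0 = ts + m.
    by apply: shift_limit ct0 cphi; near=> x; apply: thE; near: x; exact: nbhs_right_gt.
  have Eoo : thoo = nu + m.
    by apply: shift_limit ctoo cnu; near=> x; apply: thE; near: x; exact: nbhs_pinfty_gt.
  rewrite rE mulfVK ?gt_eqF // E0 Eoo; lra.
Unshelve. all: by end_near. Qed.

End rotation.

Theorem proposition3p6 (R : realType) (mum mup : R) (P : R -> 'M[R]_2)
    (beta : R) (Pstar : 'M[R]_2) (thetastar : R) :
  mum < mup ->
  class_P mum mup P ->
  cond_zero P beta Pstar ->
  is_theta_star Pstar thetastar ->
  (forall (k : int) (lambda : R) (z : R -> 'cV[R]_2),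
     is_lambda P mum mup thetastar k lambda ->
     eigenfunction P lambda z ->
     (exists r, is_rot z r) /\
     forall r, is_rot z r ->
       (0 < thetastar < pi / 2 -> k%:~R < r < k%:~R + 1) /\
       (pi / 2 < thetastar < pi -> k%:~R - 1 / 2 < r < k%:~R + 1 / 2)) /\
  (forall (k l : int) (lambdak lambdal : R) (zk zl : R -> 'cV[R]_2),
     k <> l ->
     is_lambda P mum mup thetastar k lambdak ->
     eigenfunction P lambdak zk ->
     is_lambda P mum mup thetastar l lambdal ->
     eigenfunction P lambdal zl ->
     forall rk rl, is_rot zk rk -> is_rot zl rl -> rk <> rl).
Proof.
move=> _ HP c0 hts; have pi0 := pi_gt0 R.
split=> [k lambda z lk eig|
  k l lambdak lambdal zk zl kl lk eigk ll eigl rk rl rotk rotl rkl].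
  have [alpha [a0 ex rE]] := eigenfunction_rot HP c0 hts lk eig.
  split=> // r /rE {}rE.
  (* After multiplication by [pi]: [alpha + thetastar] lies in [(0, pi)] in the first case and in
     [(pi / 2, 3 pi / 2)] in the second. *)
  by split=> /andP[? ?]; apply/andP; split; rewrite -(ltr_pM2r pi0); lra.
have [a [a0 _ /(_ _ rotk) Ek]] := eigenfunction_rot HP c0 hts lk eigk.
have [b [b0 _ /(_ _ rotl) El]] := eigenfunction_rot HP c0 hts ll eigl.
(* Equal rotations would give [(k - l) pi = a - b], but distinct integers contribute at least [pi]
   in absolute value while [|a - b| < pi / 2]. *)
have step (i j : int) : (i < j)%R -> i%:~R * pi + pi <= j%:~R * pi :> R.
  by rewrite -lezD1 -(ler_int R) rmorphD /= -(ler_pM2r pi0) mulrDl mul1r.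
rewrite rkl in Ek.
by have [/step|/step|//] := ltgtP k l; lra.
Qed.
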